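(* Let $G_{\mathbb{C}^2}:\mathbb{C}^2\to\mathbb{C}^2$ be $G_{\mathbb{C}^2}(u,v)=\bigl(1+uv+v^2,\ \tfrac12(-2+u^2+6v^2+uv(3+v^2))\bigr)$, and for $d\in\mathbb{N}$ let $g_d$ be the Chebyshev-induced morphism on $\mathbb{C}^2/D_3\simeq\mathbb{C}^2$. (1) $g_d(G_{\mathbb{C}^2}(u,v))=G_{\mathbb{C}^2}(T_d(u),T_d(v))$ for all $(u,v)\in\mathbb{C}^2$. (2) For $d\ge2$, $K(g_d|_{\mathbb{C}^2})=\{G_{\mathbb{C}^2}(2\cos3\alpha,2\cos\beta): 0\le 3\alpha,\beta<2\pi\}$.
   Context: $\mathbb{N}=\{1,2,\dots\}$. $T_d(z)$ is the one-variable Chebyshev polynomial with $T_d(s+s^{-1})=s^d+s^{-d}$. Definition of $g_d$: the Chebyshev endomorphism $P_{A_2}^d:\mathbb{C}^2\to\mathbb{C}^2$ is defined by $P_{A_2}^d(e_1(t),e_2(t))=(e_1(t^d),e_2(t^d))$ for $t=(t_1,t_2,t_3)\in(\mathbb{C}^* )^3$ with $t_1t_2t_3=1$, where $t^d=(t_1^d,t_2^d,t_3^d)$ and $e_j$ is the $j$-th elementary symmetric polynomial. With $M_2(x,y)=(x+iy,\,x-iy)$ put $f_d=M_2^{-1}\circ P_{A_2}^d\circ M_2$. The surjective map $\tilde F:\mathbb{C}^2\to\mathbb{C}^2$, $\tilde F(x,y)=(x^2+y^2,\,x^3-3xy^2)$, is the quotient map by the dihedral group $D_3\subset GL(2,\mathbb{R})$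 of order 6 generated by the rotation by $2\pi/3$ and $(x,y)\mapsto(x,-y)$; $g_d:\mathbb{C}^2\to\mathbb{C}^2$ is the unique polynomial map with $g_d\circ\tilde F=\tilde F\circ f_d$. $K(g_d|_{\mathbb{C}^2})$ is the set of $w\in\mathbb{C}^2$ whose forward orbit $\{g_d^k(w):k=1,2,\dots\}$ (iterates) is bounded in $\mathbb{C}^2$. *)

(* Defs.v *)
From mathcomp Require Import all_boot all_order all_algebra ring.
From mathcomp Require Import boolp classical_sets reals prodnormedzmodule.
From mathcomp Require Import topology normedtype.
From mathcomp Require Import trigo complex polyXY.

Set Implicit Arguments.
Unset Strict Implicit.
Unset Printing Implicit Defensive.

Import Order.TTheory GRing.Theory Num.Theory.
Import numFieldNormedType.Exports.

Local Open Scope ring_scope.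
Local Open Scope classical_set_scope.

Section ChebyshevPolynomial.
Variable R : realType.
Local Notation C := R[i].

Definition chebyshev_spec (d : nat) (T : {poly C}) : Prop :=
  forall s : C, s != 0 -> T.[s + s^-1] = s ^+ d + s ^- d.

Lemma chebyshev_exists d : exists T, chebyshev_spec d T.
Proof.
suff [T [_ [? _]]] : exists T T', chebyshev_spec d T /\ chebyshev_spec d.+1 T'.
  by exists T.
elim: d => [|d [T [T' [hT hT']]]].
  exists 2%:P, 'X; split=> s s0.
    by rewrite hornerC expr0 invr1.
  by rewrite hornerX expr1.
exists T', ('X * T' - T); split=> // s s0.
rewrite hornerD hornerN hornerM hornerX hT// hT'// -!exprVn !exprS.
have := mulfV s0; move: (s ^+ d) (s^-1 ^+ d) => a b; move: s^-1 => r rs.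
rewrite (_ : _ - _ = s * (s * a) + r * (r * b) + (s * r - 1) * (a + b)); last by ring.
by rewrite rs subrr mul0r addr0.
Qed.

Definition chebyshev (d : nat) : {poly C} :=
  projT1 (cid (chebyshev_exists d)).

Lemma chebyshevP d : chebyshev_spec d (chebyshev d).
Proof. exact: projT2 (cid (chebyshev_exists d)). Qed.

Lemma joukowski_surj (c : C) : exists2 s, s != 0 & c = s + s^-1.
Proof.
have [s] := solve_monicpoly (fun i => if i == 0%N then -1 else c) (isT : 0 < 2)%N.
rewrite 2!big_ord_recl big_ord0 /= expr0 expr1 addr0 mulr1 => hs.
have s0 : s != 0.
  by apply: contra_eq_neq hs => ->; rewrite expr0n /= mulr0 addr0 eq_sym oppr_eq0 oner_eq0.
exists s => //; apply: (mulIf s0); rewrite mulrDl mulVf// -expr2 hs; ring.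
Qed.

Lemma chebyshev_unique d T : chebyshev_spec d T -> T = chebyshev d.
Proof.
move=> hT; apply/eqP; rewrite -subr_eq0; apply: contraT => nz.
have hr c : root (T - chebyshev d) c.
  have [s s0 ->] := joukowski_surj c.
  by rewrite rootE hornerD hornerN hT// chebyshevP// subrr.
pose rs := [seq n%:R : C | n <- iota 0 (size (T - chebyshev d))].
have := @max_poly_roots _ _ rs nz; rewrite size_map size_iota ltnn; apply.
  by apply/allP => x _; exact: hr.
rewrite map_inj_uniq ?iota_uniq// => m n /eqP; rewrite eqr_nat; exact: eqP.
Qed.

End ChebyshevPolynomial.

Section ChebyshevMaps.
Variable R : realType.
Local Notation C := R[i].
Local Notation C2 := (C * C)%type.

Definition e1 (t1 t2 t3 : C) : C := t1 + t2 + t3.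
Definition e2 (t1 t2 t3 : C) : C := t1 * t2 + t1 * t3 + t2 * t3.

Definition chebA2_spec (d : nat) (P : C2 -> C2) : Prop :=
  forall t1 t2 t3 : C, t1 * t2 * t3 = 1 ->
    P (e1 t1 t2 t3, e2 t1 t2 t3) =
      (e1 (t1 ^+ d) (t2 ^+ d) (t3 ^+ d), e2 (t1 ^+ d) (t2 ^+ d) (t3 ^+ d)).

(* (p_n, p_{n+1}, p_{n+2}), where p_n is the sum of the n-th powers of the roots
   of X^3 - z X^2 + w X - 1 (Newton's identities). *)
Fixpoint power_sums (z w : C) (n : nat) : C * C * C :=
  if n is m.+1 then
    let: (a, b, c) := power_sums z w m in (b, c, z * c - w * b + a)
  else (3, z, z ^+ 2 - 2 * w).

Lemma power_sumsE t1 t2 t3 n : t1 * t2 * t3 = 1 ->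
  power_sums (e1 t1 t2 t3) (e2 t1 t2 t3) n =
  (e1 (t1 ^+ n) (t2 ^+ n) (t3 ^+ n),
   e1 (t1 ^+ n.+1) (t2 ^+ n.+1) (t3 ^+ n.+1),
   e1 (t1 ^+ n.+2) (t2 ^+ n.+2) (t3 ^+ n.+2)).
Proof.
move=> h; elim: n => [|n IH] /=; first by rewrite /e1 /e2; congr (_, _, _); ring.
rewrite IH; congr (_, _, _); rewrite -[X in _ + X]mul1r -{}h /e1 /e2 !exprS; ring.
Qed.

Local Definition psum (z w : C) n := (power_sums z w n).1.1.

Local Lemma chebA2_psum d : chebA2_spec d (fun x => (psum x.1 x.2 d, psum x.2 x.1 d)).
Proof.
move=> t1 t2 t3 h; rewrite /psum /= power_sumsE//=; congr (_, _).
set a := t2 * t3; set b := t1 * t3; set c := t1 * t2.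
have hp : a * b * c = 1.
  by rewrite -(expr1n _ 2) -h /a /b /c; ring.
have -> : e2 t1 t2 t3 = e1 a b c by rewrite /e1 /e2 /a /b /c; ring.
have -> : e1 t1 t2 t3 = e2 a b c.
  by rewrite -[LHS]mulr1 -h /e1 /e2 /a /b /c; ring.
by rewrite power_sumsE//= /e1 /e2 /a /b /c !exprMn; ring.
Qed.

Lemma chebA2_exists d : exists P, chebA2_spec d P.
Proof. by eexists; exact: chebA2_psum. Qed.

Definition chebA2 (d : nat) : C2 -> C2 := projT1 (cid (chebA2_exists d)).

Lemma chebA2P d : chebA2_spec d (chebA2 d).
Proof. exact: projT2 (cid (chebA2_exists d)). Qed.

Lemma e12_surj (z w : C) : exists t1 t2 t3,
  [/\ t1 * t2 * t3 = 1, z = e1 t1 t2 t3 & w = e2 t1 t2 t3].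
Proof.
have [x] := solve_monicpoly
  (fun i => if i == 0%N then 1 else if i == 1%N then - w else z) (isT : 0 < 3)%N.
rewrite 3!big_ord_recl big_ord0 /= expr0 mulr1 expr1 /bump /= addr0 => hx.
have x0 : x != 0.
  by apply: contra_eq_neq hx => ->; rewrite !expr0n /= !mulr0 !addr0 eq_sym oner_eq0.
have [y] := solve_monicpoly
  (fun i => if i == 0%N then - x^-1 else z - x) (isT : 0 < 2)%N.
rewrite 2!big_ord_recl big_ord0 /= expr0 expr1 addr0 mulr1 => hy.
have yq : y * (z - x - y) = x^-1 by rewrite mulrBr -expr2 hy; ring.
exists x, y, (z - x - y); split; first by rewrite -mulrA yq mulfV.
  by rewrite /e1; ring.
apply: (mulfI x0); rewrite /e2 yq !mulrDr mulfV//.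
have -> : 1 = x ^+ 3 + w * x - z * x ^+ 2 by rewrite hx; ring.
by ring.
Qed.

Lemma chebA2_unique d P : chebA2_spec d P -> P = chebA2 d.
Proof.
move=> hP; apply/funext => -[z w].
by have [t1 [t2 [t3 [h -> ->]]]] := e12_surj z w; rewrite hP// chebA2P.
Qed.

Definition M2 (x : C2) : C2 := (x.1 + 'i%C * x.2, x.1 - 'i%C * x.2).
Definition M2inv (z : C2) : C2 := ((z.1 + z.2) / 2, (z.1 - z.2) / (2 * 'i%C)).

Local Lemma iC_sqr : 'i%C * 'i%C = -1 :> C. Proof. by rewrite -expr2 sqr_i. Qed.
Local Lemma iC_neq0 : 'i%C != 0 :> C.
Proof.
apply/eqP => h; have := iC_sqr; rewrite h mulr0 => /eqP.
by rewrite eq_sym oppr_eq0 oner_eq0.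
Qed.
Local Lemma two_neq0 : 2 != 0 :> C. Proof. by rewrite pnatr_eq0. Qed.

Lemma M2K : cancel M2 M2inv.
Proof.
move=> [x y]; rewrite /M2 /M2inv /=.
by congr (_, _); move: iC_neq0; move: 'i%C => i i0; field; rewrite ?i0 ?two_neq0.
Qed.

Lemma M2invK : cancel M2inv M2.
Proof.
move=> [x y]; rewrite /M2 /M2inv /=.
by congr (_, _); move: iC_neq0; move: 'i%C => i i0; field; rewrite ?i0 ?two_neq0.
Qed.

Definition fA2 (d : nat) : C2 -> C2 := M2inv \o chebA2 d \o M2.

Definition Ftilde (x : C2) : C2 :=
  (x.1 ^+ 2 + x.2 ^+ 2, x.1 ^+ 3 - 3 * x.1 * x.2 ^+ 2).

Definition polynomial_map (g : C2 -> C2) : Prop :=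
  exists p q : {poly {poly C}},
    forall x : C2, g x = (p.[x.1, x.2], q.[x.1, x.2]).

Definition gD3_spec (d : nat) (g : C2 -> C2) : Prop :=
  polynomial_map g /\ g \o Ftilde = Ftilde \o fA2 d.

Local Definition polyfun (h : C2 -> C) :=
  exists p : {poly {poly C}}, forall x : C2, h x = p.[x.1, x.2].

Local Lemma pfc c : polyfun (fun=> c).
Proof. by exists c%:P%:P => x; rewrite !hornerC. Qed.
Local Lemma pf1 : polyfun (fun x => x.1).
Proof. by exists 'X => x; rewrite hornerX hornerC. Qed.
Local Lemma pf2 : polyfun (fun x => x.2).
Proof. by exists 'X%:P => x; rewrite hornerC hornerX. Qed.
Local Lemma pfD h k : polyfun h -> polyfun k -> polyfun (fun x => h x + k x).
Proof. by move=> [q hq] [r hr]; exists (q + r) => x; rewrite !hornerD hq hr. Qed.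
Local Lemma pfM h k : polyfun h -> polyfun k -> polyfun (fun x => h x * k x).
Proof. by move=> [q hq] [r hr]; exists (q * r) => x; rewrite !hornerM hq hr. Qed.
Local Lemma pfN h : polyfun h -> polyfun (fun x => - h x).
Proof. by move=> [q hq]; exists (- q) => x; rewrite !hornerN hq. Qed.
Local Lemma pfX h n : polyfun h -> polyfun (fun x => h x ^+ n).
Proof. by move=> [q hq]; exists (q ^+ n) => x; rewrite !horner_exp hq. Qed.

Ltac pf := repeat first [ assumption | apply: pf1 | apply: pf2 | apply: pfN
  | apply: pfD | apply: pfM | apply: pfX | apply: pfc ].

Local Definition uv (z w : C) : C2 := (z * w, (z ^+ 3 + w ^+ 3) / 2).

Local Lemma F_uv x : Ftilde (M2inv x) = uv x.1 x.2.
Proof.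
rewrite /Ftilde /uv /M2inv /=; move: iC_sqr iC_neq0; move: 'i%C => i i2 i0.
have -> : (x.1 - x.2) / (2 * i) = - i * (x.1 - x.2) / 2.
  rewrite invfM (_ : i^-1 = - i) ?mulrA; last first.
    by apply: (mulIf i0); rewrite mulVf// mulNr i2 opprK.
  by field.
have -> : (- i * (x.1 - x.2) / 2) ^+ 2 = - ((x.1 - x.2) / 2) ^+ 2.
  by rewrite -[RHS]mulN1r -i2; field.
by congr (_, _); field.
Qed.

(* With u = z w and 2 v = z^3 + w^3, p_n(z, w) is a polynomial in (u, v) times
   1, z, w plus one times z^3, w^2, z^2, according to n mod 3. *)
Local Lemma psum_decomp k : exists a b c a' b' c' : C2 -> C,
  [/\ [/\ polyfun a, polyfun b & polyfun c],
      [/\ polyfun a', polyfun b' & polyfun c'] &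
      forall z w, power_sums z w (3 * k) =
        (a (uv z w) + a' (uv z w) * z ^+ 3,
         b (uv z w) * z + b' (uv z w) * w ^+ 2,
         c (uv z w) * w + c' (uv z w) * z ^+ 2)].
Proof.
elim: k => [|k [a [b [c [a' [b' [c' [[ha hb hc] [ha' hb' hc'] h]]]]]]]].
  exists (fun=> 3), (fun=> 1), (fun=> -2), (fun=> 0), (fun=> 0), (fun=> 1).
  split; [by split; pf|by split; pf|move=> z w].
  by rewrite muln0 /=; congr (_, _, _); ring.
pose A x := c x * x.1 - b x * x.1 - 2 * x.2 * b' x + a x.
pose A' x := c' x + b' x + a' x.
pose B x := A x + 2 * x.2 * A' x - c' x * x.1 + b x.
pose B' x := - x.1 * A' x - c x + b' x.
pose D x := B' x * x.1 - A x + c x.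
pose D' x := B x - A' x * x.1 + c' x.
exists A, B, D, A', B', D'; split.
- by split; rewrite /D /B /B' /A /A'; pf.
- by split; rewrite /D' /B /B' /A /A'; pf.
move=> z w; rewrite mulnS addnC !addnS addn0 /= h {h} /D /D' /B /B' /A /A'.
move: (a _) (b _) (c _) (a' _) (b' _) (c' _) => {ha hb hc ha' hb' hc'}a1 b1 c1 a2 b2 c2.
rewrite /uv /=.
by congr (_, _, _); field.
Qed.

Lemma gD3_exists d : exists g, gD3_spec d g.
Proof.
suff [h1 [h2 [[q1 hq1] [q2 hq2] h]]] : exists h1 h2, [/\ polyfun h1, polyfun h2 &
    forall z w, uv (psum z w d) (psum w z d) = (h1 (uv z w), h2 (uv z w))].
  exists (fun x => (h1 x, h2 x)); split.
    by exists q1, q2 => x; rewrite hq1 hq2.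
  apply/funext => x; rewrite -{1}[x]M2K /= !F_uv -h /fA2 /=.
  by rewrite -(chebA2_unique (@chebA2_psum d)).
rewrite (divn_eq d 3) mulnC.
have [a [b [c [a' [b' [c' [[ha hb hc] [ha' hb' hc'] h]]]]]]] := psum_decomp (d %/ 3).
have uvC z w : uv w z = uv z w by rewrite /uv; congr (_, _); field.
have : (d %% 3 < 3)%N by rewrite ltn_mod.
case: (d %% 3)%N => [|[|[|//]]] _.
- pose h1 x := a x ^+ 2 + 2 * a x * a' x * x.2 + a' x ^+ 2 * x.1 ^+ 3.
  pose h2 x := a x ^+ 3 + 3 * a x ^+ 2 * a' x * x.2
    + 3 * a x * a' x ^+ 2 * (2 * x.2 ^+ 2 - x.1 ^+ 3)
    + a' x ^+ 3 * (4 * x.2 ^+ 3 - 3 * x.1 ^+ 3 * x.2).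
  exists h1, h2; split; [by rewrite /h1; pf|by rewrite /h2; pf|move=> z w].
  rewrite /psum addn0 !h /= (uvC z w) /h1 /h2.
  by move: (a _) (a' _) => A A'; rewrite /uv /=; congr (_, _); field.
- pose h1 x := b x ^+ 2 * x.1 + 2 * b x * b' x * x.2 + b' x ^+ 2 * x.1 ^+ 2.
  pose h2 x := b x ^+ 3 * x.2 + 3 * b x ^+ 2 * b' x * x.1 ^+ 2
    + 3 * b x * b' x ^+ 2 * x.1 * x.2 + b' x ^+ 3 * (2 * x.2 ^+ 2 - x.1 ^+ 3).
  exists h1, h2; split; [by rewrite /h1; pf|by rewrite /h2; pf|move=> z w].
  rewrite /psum addn1 /= !h /= (uvC z w) /h1 /h2.
  by move: (b _) (b' _) => A A'; rewrite /uv /=; congr (_, _); field.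
- pose h1 x := c x ^+ 2 * x.1 + 2 * c x * c' x * x.2 + c' x ^+ 2 * x.1 ^+ 2.
  pose h2 x := c x ^+ 3 * x.2 + 3 * c x ^+ 2 * c' x * x.1 ^+ 2
    + 3 * c x * c' x ^+ 2 * x.1 * x.2 + c' x ^+ 3 * (2 * x.2 ^+ 2 - x.1 ^+ 3).
  exists h1, h2; split; [by rewrite /h1; pf|by rewrite /h2; pf|move=> z w].
  rewrite /psum addn2 /= !h /= (uvC z w) /h1 /h2.
  by move: (c _) (c' _) => A A'; rewrite /uv /=; congr (_, _); field.
Qed.

Definition gD3 (d : nat) : C2 -> C2 := projT1 (cid (gD3_exists d)).

Lemma gD3P d : gD3_spec d (gD3 d).
Proof. exact: projT2 (cid (gD3_exists d)). Qed.

Lemma Ftilde_surj (w : C2) : exists x, w = Ftilde x.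
Proof.
suff [z [z' ->]] : exists z z', w = uv z z'.
  by exists (M2inv (z, z')); rewrite F_uv.
case: w => u v; have [y] := solve_monicpoly
  (fun i => if i == 0%N then - u ^+ 3 else 2 * v) (isT : 0 < 2)%N.
rewrite 2!big_ord_recl big_ord0 /= expr0 expr1 addr0 mulr1 => hy.
have cbrt c : exists z : C, z ^+ 3 = c.
  have [z] := solve_monicpoly
    (fun i => if i == 0%N then c else 0) (isT : 0 < 3)%N.
  by rewrite 3!big_ord_recl big_ord0 /= expr0 !mul0r !addr0 mulr1 => hz; exists z.
have [z hz] := cbrt y; have [y0|y0] := eqVneq y 0.
  have [w hw] := cbrt (2 * v); have u0 : u = 0.
    move: hy; rewrite y0 expr0n mulr0 addr0 => /esym/eqP.
    by rewrite oppr_eq0 expf_eq0 => /= /eqP.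
  exists 0, w; rewrite /uv u0 mul0r expr0n hw add0r; congr (_, _).
  by rewrite mulrC mulKf ?two_neq0.
have z0 : z != 0 by apply: contra_neq y0 => z0; rewrite -hz z0 expr0n.
exists z, (u / z); rewrite /uv mulrC divfK// exprMn exprVn hz; congr (_, _).
have -> : u ^+ 3 / y = 2 * v - y.
  apply: (mulIf y0); rewrite divfK// mulrBl -expr2 hy; ring.
by rewrite addrC subrK mulrC mulKf ?two_neq0.
Qed.

Lemma gD3_unique d g : gD3_spec d g -> g = gD3 d.
Proof.
move=> [_ hg]; apply/funext => -[u v]; have [x ->] := Ftilde_surj (u, v).
have [_ hd] := gD3P d.
by have /= -> := congr1 (fun h => h x) hg; have /= -> := congr1 (fun h => h x) hd.
Qed.

Definition GC2 (x : C2) : C2 :=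
  let: (u, v) := x in
  (1 + u * v + v ^+ 2,
   2^-1 * (- 2 + u ^+ 2 + 6 * v ^+ 2 + u * v * (3 + v ^+ 2))).

(* R[i]^o is R[i] as a normed module over itself; the norm on the product is
   the maximum of the two moduli. *)
Definition bounded_C2 (A : set C2) : Prop :=
  bounded_set (A : set (C^o * C^o)%type).

Definition filled_julia (g : C2 -> C2) : set C2 :=
  [set w | bounded_C2 [set iter k g w | k in [set k : nat | (1 <= k)%N]]].

Local Lemma prod_norm_le (K : numFieldType) (U V : normedModType K) (x : U * V) (c : K) :
  (`|x| <= c) = (`|x.1| <= c) && (`|x.2| <= c).
Proof. by rewrite prod_normE comparable_ge_max// real_comparable// normr_real. Qed.

Lemma bounded_C2P (A : set C2) : bounded_C2 A <->
  exists M : R, forall x, A x -> `|x.1| <= M%:C%C /\ `|x.2| <= M%:C%C.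
Proof.
split=> [[M [Mr hM]]|[M hM]].
  have M1 : M < M + 1 by rewrite ltrDl.
  exists (complex.Re (M + 1)) => x Ax; apply/andP.
  rewrite (_ : (complex.Re (M + 1))%:C%C = M + 1); last first.
    by apply/RRe_real; rewrite realD// real1.
  by have := hM _ M1 x Ax; rewrite /= prod_norm_le.
exists M%:C%C; split; first by rewrite complex_real.
by move=> c /ltW Mc x /hM[x1 x2]; rewrite /= prod_norm_le !(le_trans _ Mc).
Qed.

End ChebyshevMaps.

Arguments chebyshev R d : clear implicits.
Arguments chebA2 R d : clear implicits.
Arguments fA2 R d : clear implicits.
Arguments gD3 R d : clear implicits.

(* Main.v *)
(** For t = (x r, x / r, x^-2), which has product 1, the point
    (e_1(t) e_2(t), (e_1(t)^3 + e_2(t)^3) / 2) equals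
    G(x^3 + x^-3, r + r^-1), and every point of C^2 is of this form.  Since
    g_d raises t to the power d, (1) follows.  For (2), a bounded g_d-orbit
    gives bounded e_1 and e_2 along the orbit, hence bounded powers t_i^(d^k);
    as the product of the t_i is 1, all of them have modulus 1, and then
    x^3 + x^-3 and r + r^-1 lie in the real interval [-2, 2]. *)
Require Import Defs.
From mathcomp Require Import all_boot all_order all_algebra ring.
From mathcomp Require Import classical_sets reals trigo complex.

Import Order.TTheory GRing.Theory Num.Theory.
Local Open Scope ring_scope.
Local Open Scope classical_set_scope.

(** * Root bounds and growth of powers *)

(** A Cauchy-type bound: if [|t| > 1], every [|t| ^ i] with [i <= n] is at most [|t| ^ n], and this
    factor cancels from the equation. *)
Lemma monic_root_bound (K : numFieldType) (n : nat) (c : 'I_n.+1 -> K) (t : K) :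
  t ^+ n.+1 = \sum_(i < n.+1) c i * t ^+ i -> `|t| <= 1 + \sum_(i < n.+1) `|c i|.
Proof.
move=> ht; have c0 : 0 <= \sum_(i < n.+1) `|c i| by apply: sumr_ge0.
have [t1|t1] := real_leP (normr_real t) (real1 K).
  by rewrite (le_trans t1)// lerDl.
have tn0 : 0 < `|t| ^+ n by rewrite exprn_gt0// (lt_trans ltr01).
suff : `|t| <= \sum_(i < n.+1) `|c i| by move=> /le_trans; apply; rewrite lerDr.
rewrite -(ler_pM2r tn0) -exprS -normrX ht (le_trans (ler_norm_sum _ _ _))//.
rewrite mulr_suml ler_sum// => i _; rewrite normrM normrX ler_wpM2l//.
by rewrite ler_weXn2l// ?ltW// -ltnS.
Qed.

Lemma bernoulli_ineq (K : realDomainType) (a : K) (n : nat) :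
  0 <= a -> 1 + a *+ n <= (1 + a) ^+ n.
Proof.
move=> a0; elim: n => [|n IH]; first by rewrite expr0 mulr0n addr0.
rewrite exprS mulrDl mul1r mulrSr addrA lerD// -[leLHS]mulr1 ler_wpM2l//.
by rewrite exprn_ege1// lerDl.
Qed.

(** If [a > 1], Bernoulli's inequality makes the powers of [a] grow at least linearly, so they
    exceed any [M]. *)
Lemma bounded_pow_le1 (K : archiRealFieldType) (a M : K) (d : nat) :
  (1 < d)%N -> 0 <= a -> (forall k, (1 <= k)%N -> a ^+ (d ^ k) <= M) -> a <= 1.
Proof.
move=> d1 a0 h; rewrite leNgt; apply/negP => a1.
have b0 : 0 < a - 1 by rewrite subr_gt0.
have := archi_boundP (divr_ge0 (normr_ge0 M) (ltW b0)).
set n := Num.bound _; rewrite ltr_pdivrMr// => hn.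
suff : M < M by rewrite ltxx.
apply: (le_lt_trans (ler_norm M)); apply: (lt_le_trans hn).
(* The index [n.+1] is positive, as [h] requires, and [d ^ n.+1] exceeds [n] because [d > 1]. *)
apply: (le_trans _ (h n.+1 isT)).
have := bernoulli_ineq _ (a - 1) n (ltW b0); rewrite subrKC => hb.
rewrite mulr_natl; apply: (@le_trans _ _ (a ^+ n)).
  by apply: le_trans hb; rewrite lerDr.
apply: ler_weXn2l; first exact: ltW.
by rewrite (leq_trans (leqnSn n))// ltnW// ltn_expl.
Qed.

(** * Parametrization of the quotient and part (1) *)

Section ChebyshevQuotient.
Set Implicit Arguments.
Unset Strict Implicit.

Variable R : realType.
Local Notation C := R[i].
Implicit Types (x r s t z w u v : C).

(** Parametrizes the quotient by the torus [t1 * t2 * t3 = 1], on which [gD3] acts by raising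
    coordinates to powers. *)
Definition e1e2_quotient (t1 t2 t3 : C) : C * C :=
  Ftilde (M2inv (e1 t1 t2 t3, e2 t1 t2 t3)).

Lemma gD3_quotient d t1 t2 t3 : t1 * t2 * t3 = 1 ->
  gD3 R d (e1e2_quotient t1 t2 t3) =
  e1e2_quotient (t1 ^+ d) (t2 ^+ d) (t3 ^+ d).
Proof.
move=> h; have [_ /(congr1 (fun f => f (M2inv (e1 t1 t2 t3, e2 t1 t2 t3)))) /=] :=
  @gD3P R d.
by rewrite /e1e2_quotient => ->; rewrite /fA2 /= M2invK chebA2P.
Qed.

Lemma iter_gD3_quotient d k t1 t2 t3 : t1 * t2 * t3 = 1 ->
  iter k (gD3 R d) (e1e2_quotient t1 t2 t3) =
  e1e2_quotient (t1 ^+ (d ^ k)) (t2 ^+ (d ^ k)) (t3 ^+ (d ^ k)).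
Proof.
move=> h; elim: k => [|k IH]; first by rewrite expn0 !expr1.
by rewrite iterS IH gD3_quotient ?expnSr ?exprM// -!exprMn h expr1n.
Qed.

Lemma GC2_quotient x r : x != 0 -> r != 0 ->
  GC2 (x ^+ 3 + x ^- 3, r + r^-1) = e1e2_quotient (x * r) (x / r) (x ^- 2).
Proof.
move=> x0 r0; rewrite /e1e2_quotient Defs.F_uv /Defs.uv /GC2 /e1 /e2 /=.
by congr (_, _); field; rewrite ?x0 ?r0.
Qed.

Lemma cube_root_exists z : exists x, x ^+ 3 = z.
Proof.
have [x] := solve_monicpoly (fun i => if i == 0%N then z else 0) (isT : 0 < 3)%N.
by rewrite 3!big_ord_recl big_ord0 /= expr0 !mul0r !addr0 mulr1; exists x.
Qed.

Lemma gD3_GC2 d u v :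
  gD3 R d (GC2 (u, v)) = GC2 ((chebyshev R d).[u], (chebyshev R d).[v]).
Proof.
have [s s0 ->] := joukowski_surj u; have [r r0 ->] := joukowski_surj v.
(* The first argument of [GC2] must have the form [x ^+ 3 + x ^- 3], hence the cube root. *)
rewrite !chebyshevP//; have [x xs] := cube_root_exists s; subst s.
have x0 : x != 0 by apply: contra_neq s0 => ->; rewrite expr0n.
rewrite GC2_quotient// gD3_quotient; last by field; rewrite r0 x0.
have X3 : (x ^+ 3) ^+ d = (x ^+ d) ^+ 3 by rewrite exprAC.
rewrite X3 GC2_quotient ?expf_neq0//.
by rewrite !exprMn !exprVn (exprAC _ 2).
Qed.

(** Both [Ftilde] and [(e1, e2)] are onto. Given the [t_i], let [x] be a square root of
    [t3^-1 = t1 * t2] and [r = t1 / x]; then [x / r = x ^+ 2 / t1 = t2]. *)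
Lemma e1e2_quotient_surj w v : exists x r, [/\ x != 0, r != 0 &
  (w, v) = e1e2_quotient (x * r) (x / r) (x ^- 2)].
Proof.
have [[z1 z2] ->] := Ftilde_surj (w, v).
have [t1 [t2 [t3 [h hz hw]]]] := e12_surj (M2 (z1, z2)).1 (M2 (z1, z2)).2.
have t30 : t3 != 0.
  by apply: contra_eq_neq h => ->; rewrite mulr0 eq_sym oner_eq0.
have t10 : t1 != 0.
  by apply: contra_eq_neq h => ->; rewrite !mul0r eq_sym oner_eq0.
have x2 := sqrtCK (t3^-1); set x := sqrtC _ in x2.
have x0 : x != 0.
  apply: contra_neq t30 => x0; move: x2.
  by rewrite x0 expr0n => /esym/eqP; rewrite invr_eq0 => /eqP.
exists x, (t1 / x); split; rewrite ?mulf_neq0 ?invr_eq0//.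
have -> : x * (t1 / x) = t1 by rewrite mulrC divfK.
have -> : x / (t1 / x) = t2.
  rewrite invf_div mulrA -expr2 x2; apply: (mulIf t10); rewrite divfK//.
  by apply: (mulIf t30); rewrite mulVf// -h; ring.
by rewrite x2 invrK /e1e2_quotient -hz -hw -surjective_pairing M2K.
Qed.

(** * Bounded orbits come from unimodular parameters *)

(** [t1] is a root of [X^3 - e1 X^2 + e2 X - 1]; the constant 2 is the 1 of the root bound plus the
    modulus of the constant term. *)
Lemma root_e12_bound t1 t2 t3 : t1 * t2 * t3 = 1 ->
  `|t1| <= 2 + `|e1 t1 t2 t3| + `|e2 t1 t2 t3|.
Proof.
move=> h; pose c (i : 'I_3) := [:: 1; - e2 t1 t2 t3; e1 t1 t2 t3]`_i.
have := @monic_root_bound _ 2 c t1; rewrite !big_ord_recl !big_ord0 /c /=.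
rewrite normr1 normrN addr0 expr0 => /(_ _)/le_trans; apply; last first.
  by rewrite le_eqVlt; apply/orP; left; apply/eqP; ring.
have ht : t1 ^+ 3 = t1 * t2 * t3 - e2 t1 t2 t3 * t1 + e1 t1 t2 t3 * t1 ^+ 2.
  by rewrite /e1 /e2; ring.
by rewrite ht h /bump /=; ring.
Qed.

(* Cauchy's bound: z^3 is a root of X^2 - 2 v X + u^3, where (u, v) = Ftilde (M2inv (z, w)). *)
Lemma quotient_e1_bound z w :
  `|z| ^+ 3 <= 1 + `|(Ftilde (M2inv (z, w))).1| ^+ 3
                 + 2 * `|(Ftilde (M2inv (z, w))).2|.
Proof.
rewrite Defs.F_uv /Defs.uv /=.
pose c (i : 'I_2) := [:: - (z * w) ^+ 3; z ^+ 3 + w ^+ 3]`_i.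
have := @monic_root_bound _ 1 c (z ^+ 3); rewrite !big_ord_recl !big_ord0 /c /=.
rewrite addr0 normrN !normrX => /(_ _)/le_trans; apply.
  by rewrite expr0 expr1 /bump /=; ring.
rewrite addrA lerD2l normrM normfV normr_nat mulrC divfK//.
  by rewrite addr0.
by rewrite pnatr_eq0.
Qed.


(** For [|z| > 1] one has [|z| <= |z| ^ 3], which [quotient_e1_bound] controls; otherwise the right
    side already exceeds 1. *)
Lemma e1_le_quotient z w (N : C) :
  `|(Ftilde (M2inv (z, w))).1| <= N -> `|(Ftilde (M2inv (z, w))).2| <= N ->
  `|z| <= 2 + N ^+ 3 + 2 * N.
Proof.
move=> h1 h2; have N0 : 0 <= N := le_trans (normr_ge0 _) h1.
have [z1|z1] := real_leP (normr_real z) (real1 _).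
  rewrite (le_trans z1)// -addrA -subr_ge0 (_ : _ - 1 = 1 + N ^+ 3 + 2 * N); last by ring.
  by rewrite !addr_ge0// ?exprn_ge0// mulr_ge0.
apply: (@le_trans _ _ (`|z| ^+ 3)).
  by rewrite -[leLHS]expr1 ler_weXn2l// ltW.
apply: (le_trans (quotient_e1_bound z w)).
rewrite !lerD// ?ler_wpM2l// ?ler1n//.
by rewrite lerXn2r// nnegrE.
Qed.

Lemma t_le_quotient t1 t2 t3 (N : C) : t1 * t2 * t3 = 1 ->
  `|(e1e2_quotient t1 t2 t3).1| <= N -> `|(e1e2_quotient t1 t2 t3).2| <= N ->
  `|t1| <= 2 + (2 + N ^+ 3 + 2 * N) + (2 + N ^+ 3 + 2 * N).
Proof.
move=> h h1 h2; apply: (le_trans (root_e12_bound h)); rewrite !lerD//.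
  exact: e1_le_quotient h1 h2.
(* Swapping [z] and [w] fixes the quotient point, so the bound on [e1] also bounds [e2]. *)
have sym z w : Ftilde (M2inv (z, w)) = Ftilde (M2inv (w, z)).
  by rewrite !Defs.F_uv /Defs.uv /=; congr (_, _); ring.
by move: h1 h2; rewrite /e1e2_quotient sym; apply: e1_le_quotient.
Qed.

(** The orbit bound [M] yields one bound on all [|t1| ^ (d ^ k)] with [k >= 1], so [bounded_pow_le1]
    applies once moduli are read as elements of [R]. *)
Lemma bounded_orbit_le1 d t1 t2 t3 : (2 <= d)%N -> t1 * t2 * t3 = 1 ->
  filled_julia (gD3 R d) (e1e2_quotient t1 t2 t3) -> `|t1| <= 1.
Proof.
move=> d2 h /bounded_C2P[M hM].
rewrite -(RRe_real (normr_real t1)) (_ : 1 = 1%:C%C)// lecR.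
apply: (@bounded_pow_le1 _ _ (2 + (2 + M ^+ 3 + 2 * M) + (2 + M ^+ 3 + 2 * M)) _ d2).
  by rewrite -lecR RRe_real ?normr_real//; exact: normr_ge0.
move=> k k1; rewrite -lecR.
have -> : (complex.Re `|t1| ^+ (d ^ k))%:C%C = `|t1 ^+ (d ^ k)|.
  by rewrite normrX -[in RHS](RRe_real (normr_real t1)); exact: rmorphXn.
have [] := hM (iter k (gD3 R d) (e1e2_quotient t1 t2 t3)); first by exists k.
rewrite iter_gD3_quotient// => h1 h2.
have hp : t1 ^+ (d ^ k) * t2 ^+ (d ^ k) * t3 ^+ (d ^ k) = 1.
  by rewrite -!exprMn h expr1n.
rewrite (le_trans (t_le_quotient hp h1 h2))//.
by rewrite !(rmorphD, rmorphM, rmorphXn, rmorph_nat) /=.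
Qed.

(** Permuting the parameters does not move the quotient point, so all three have modulus at most 1.
    Then [|x ^- 2| <= 1] and [|x| ^ 2 = |x * r| |x / r| <= 1] force [|x| = 1], after which [|r|] and
    [|r^-1|] are both at most 1. *)
Lemma bounded_orbit_norm1 d x r : (2 <= d)%N -> x != 0 -> r != 0 ->
  filled_julia (gD3 R d) (e1e2_quotient (x * r) (x / r) (x ^- 2)) ->
  `|x| = 1 /\ `|r| = 1.
Proof.
move=> d2 x0 r0 hK.
have h1 : x * r * (x / r) * x ^- 2 = 1 by field; rewrite r0 x0.
have h2 : x / r * (x * r) * x ^- 2 = 1 by field; rewrite r0 x0.
have h3 : x ^- 2 * (x * r) * (x / r) = 1 by field; rewrite r0 x0.
have := bounded_orbit_le1 d2 h1 hK.
have := @bounded_orbit_le1 _ _ _ _ d2 h2; have := @bounded_orbit_le1 _ _ _ _ d2 h3.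
have -> : e1e2_quotient (x ^- 2) (x * r) (x / r) =
    e1e2_quotient (x * r) (x / r) (x ^- 2).
  by rewrite /e1e2_quotient /e1 /e2; congr (Ftilde (M2inv (_, _))); ring.
have -> : e1e2_quotient (x / r) (x * r) (x ^- 2) =
    e1e2_quotient (x * r) (x / r) (x ^- 2).
  by rewrite /e1e2_quotient /e1 /e2; congr (Ftilde (M2inv (_, _))); ring.
move=> /(_ hK) a3 /(_ hK) a2 a1.
have nx : `|x| = 1.
  apply/eqP; rewrite eq_le; apply/andP; split.
    rewrite -(@expr_le1 _ 2 `|x|)// -normrX (_ : x ^+ 2 = (x * r) * (x / r)).
      by rewrite normrM mulr_ile1.
    by field.
  by move: a3; rewrite normfV normrX invf_le1 ?exprn_gt0 ?normr_gt0// expr_ge1.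
move: a1 a2; rewrite !normrM normfV nx !mul1r invf_le1 ?normr_gt0// => a1 a2.
by split=> //; apply/eqP; rewrite eq_le a1.
Qed.

(** * Unimodular numbers, cosines and the bound on the image *)

Lemma norm1_joukowski s : `|s| = 1 ->
  exists2 a : R, 0 <= a < 2 * pi & s + s^-1 = (2 * cos a)%:C%C.
Proof.
case: s => p q; rewrite normc_def /= => -[].
move=> /(congr1 (fun y => y ^+ 2)); rewrite sqr_sqrtr ?addr_ge0 ?sqr_ge0// expr1n => pq.
have p1 : -1 <= p <= 1 by rewrite -ler_norml -(@expr_le1 _ 2 `|p|)// -normrX ger0_norm ?sqr_ge0// -pq lerDl sqr_ge0.
(* On the unit circle [s^-1] is the conjugate of [s], so the sum is [2 * p]; the angle can be taken
   in [[0, pi]]. *)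
exists (acos p); last first.
  rewrite acosK// /GRing.inv /= pq !divr1; apply/eqP; rewrite eq_complex /=.
  by apply/andP; split; apply/eqP; ring.
rewrite acos_ge0//= (le_lt_trans (acos_lepi p1))//.
by rewrite mulr_natl mulr2n ltrDl pi_gt0.
Qed.

Lemma joukowski_cos (a : R) :
  exists2 s : C, `|s| = 1 & (2 * cos a)%:C%C = s + s^-1.
Proof.
exists (cos a +i* sin a)%C; first by rewrite normc_def /= cos2Dsin2 sqrtr1.
rewrite /GRing.inv /= cos2Dsin2 !divr1; apply/eqP; rewrite eq_complex /=.
by apply/andP; split; apply/eqP; ring.
Qed.

Lemma norm_joukowski_le2 s : `|s| = 1 -> `|s + s^-1| <= 2.
Proof.
move=> s1; rewrite (le_trans (ler_normD _ _))// normfV s1 invr1.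
by rewrite -[2]/(1 + 1).
Qed.

Lemma iter_gD3_joukowski d k s r : s != 0 -> r != 0 ->
  iter k (gD3 R d) (GC2 (s + s^-1, r + r^-1)) =
  GC2 (s ^+ (d ^ k) + s ^- (d ^ k), r ^+ (d ^ k) + r ^- (d ^ k)).
Proof.
move=> s0 r0; elim: k => [|k IH]; first by rewrite expn0 !expr1.
rewrite iterS IH gD3_GC2 !chebyshevP ?expf_neq0//.
by rewrite -!exprM -!expnSr.
Qed.

(** The triangle inequality gives 9 for the first coordinate and half of [2 + 4 + 24 + 28 = 58] for
    the second. *)
Lemma norm_GC2_le u v : `|u| <= 2 -> `|v| <= 2 ->
  `|(GC2 (u, v)).1| <= 29 :> C /\ `|(GC2 (u, v)).2| <= 29 :> C.
Proof.
move=> hu hv.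
have M a b (x y : C) : `|x| <= a%:R -> `|y| <= b%:R -> `|x * y| <= (a * b)%:R.
  by move=> hx hy; rewrite normrM natrM ler_pM.
have A a b (x y : C) : `|x| <= a%:R -> `|y| <= b%:R -> `|x + y| <= (a + b)%:R.
  by move=> hx hy; rewrite (le_trans (ler_normD _ _))// natrD lerD.
have n m : `|m%:R : C| <= m%:R by rewrite normr_nat.
have N (x : C) : `|- x| = `|x| by rewrite normrN.
have h2 (x : C) : `|x| <= 58 -> `|2^-1 * x| <= 29.
  move=> hx; rewrite normrM normfV normr_nat mulrC ler_pdivrMr ?ltr0n//.
  by rewrite -natrM.
rewrite /GC2 /=; split.
  apply: (@le_trans _ _ (1 + 2 * 2 + 2 * 2)%:R); last by rewrite ler_nat.
  by rewrite !expr2; apply: (A); [apply: (A); [exact: (n 1)|exact: M]|exact: M].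
apply: h2; apply: (@le_trans _ _ (2 + 2 * 2 + 6 * (2 * 2) + 2 * 2 * (3 + 2 * 2))%:R).
  by rewrite !expr2; apply: (A); [apply: (A); [apply: (A)|]|];
    rewrite ?N; repeat first [exact: n | assumption | apply: (M) | apply: (A)].
by rewrite ler_nat.
Qed.

End ChebyshevQuotient.

Theorem theorem3p3 (R : realType) (d : nat) (hd : (1 <= d)%N) :
  (forall u v : R[i],
     gD3 R d (GC2 (u, v)) = GC2 ((chebyshev R d).[u], (chebyshev R d).[v])) /\
  ((2 <= d)%N ->
   filled_julia (gD3 R d) =
   [set w | exists alpha beta : R,
      [/\ 0 <= 3 * alpha < 2 * pi, 0 <= beta < 2 * pi &
          w = GC2 ((2 * cos (3 * alpha))%:C%C, (2 * cos beta)%:C%C)]]).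
Proof.
split=> [u v|d2]; first exact: gD3_GC2.
apply/seteqP; split=> [[w1 w2] hw|_ [a [b [_ _ ->]]]].
  have [x [r [x0 r0 ew]]] := e1e2_quotient_surj w1 w2.
  rewrite ew in hw *; have [x1 r1] := bounded_orbit_norm1 d2 x0 r0 hw.
  have [|a ha ea] := @norm1_joukowski R (x ^+ 3); first by rewrite normrX x1 expr1n.
  have [b hb eb] := norm1_joukowski r1.
  (* The angle [a] belongs to [x ^+ 3], so [alpha = a / 3] gives [3 * alpha = a]. *)
  exists (a / 3), b; rewrite mulrCA mulfV ?mulr1 ?pnatr_eq0//; split=> //.
  by rewrite -GC2_quotient// ea eb.
(* Conversely, powers of unimodular [s] and [r] stay unimodular, so the arguments of [GC2] along the
   orbit have modulus at most 2. *)
have [s s1 ->] := joukowski_cos (3 * a); have [r r1 ->] := joukowski_cos b.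
apply/bounded_C2P; exists 29 => _ [k _ <-].
have nz (z : R[i]) : `|z| = 1 -> z != 0 by rewrite -normr_eq0 => ->; exact: oner_neq0.
rewrite iter_gD3_joukowski ?nz// rmorph_nat.
by apply: norm_GC2_le; apply: norm_joukowski_le2; rewrite normrX ?s1 ?r1 expr1n.
Qed.
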